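(* Let $\varepsilon,\alpha,\beta\in(0,1/2]$. Let $\mathcal{H}$ be a finite candidate set and, for every pair $H,H'\in\mathcal{H}$, let $\psi_{H,H'}:\mathcal{Z}\to[-1,1]$ be a comparison function. Let $\mathcal{D}$ be a distribution over $\mathcal{Z}$ and assume there exists $H^*\in\mathcal{H}$ with $\mathrm{score}^\psi_{H^*}(\mathcal{D})\le0.1\alpha$. Then there exists an $\varepsilon$-user-level DP algorithm which, with probability at least $1-\beta$ (over its randomness and the input $\mathbf{x}\sim(\mathcal{D}^m)^n$), outputs $H\in\mathcal{H}$ with $\mathrm{score}^\psi_H(\mathcal{D})\le0.5\alpha$, as long as \[ n\ge\tilde{\Theta}\left(\frac{\log(|\mathcal{H}|/\beta)}{\varepsilon}+\frac{\log(|\mathcal{H}|/\beta)}{\alpha\varepsilon\sqrt{m}}+\frac{\log(|\mathcal{H}|/\beta)}{\alpha^2 m}\right). \]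
   Context: User-level DP: there are $n$ users each holding $m$ examples from $\mathcal{Z}$; two inputs in $\mathcal{Z}^{nm}$ are user-level neighbors if they differ only in one user's $m$ examples; an algorithm is $\varepsilon$-user-level DP if $\Pr[\mathbf{A}(\mathbf{x})\in S]\le e^\varepsilon\Pr[\mathbf{A}(\mathbf{x}')\in S]$ for all neighbors and all output sets $S$. Distributional scores: $\mathrm{pscore}^\psi_{H,H'}(\mathcal{D})=\mathbb{E}_{x\sim\mathcal{D}}[\psi_{H,H'}(x)]$ and $\mathrm{score}^\psi_H(\mathcal{D})=\max_{H'\in\mathcal{H}\setminus\{H\}}\mathrm{pscore}^\psi_{H,H'}(\mathcal{D})$. $\tilde{\Theta}$ hides polylogarithmic factors. *)

(* Defs.v *)
From HB Require Import structures.
From mathcomp Require Import all_boot all_order all_algebra.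
From mathcomp Require Import all_classical all_reals all_analysis.

Set Implicit Arguments.
Unset Strict Implicit.
Unset Printing Implicit Defensive.

Import Order.TTheory GRing.Theory Num.Theory.
Import numFieldNormedType.Exports.

Local Open Scope classical_set_scope.
Local Open Scope ring_scope.

(* A finite type with the discrete sigma-algebra. Measurable types are pointed
   in the library, so the alias carries an element of the type. *)
Definition discrete (H : finType) (h0 : H) : Type := H.

Section discrete_instances.
Variables (H : finType) (h0 : H).

HB.instance Definition _ := Finite.copy (discrete h0) H.
HB.instance Definition _ := isPointed.Build (discrete h0) h0.
HB.instance Definition _ := @isMeasurable.Build default_measure_display
  (discrete h0) discrete_measurable discrete_measurable0
  discrete_measurableC discrete_measurableU.

End discrete_instances.

Section product_distribution.
Context {d : measure_display} {T : measurableType d} {R : realType}.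

Definition tuple_cons (n : nat) (p : T * n.-tuple T) : n.+1.-tuple T :=
  [tuple of p.1 :: p.2].

Lemma measurable_tuple_cons (n : nat) :
  measurable_fun [set: T * n.-tuple T] (@tuple_cons n).
Proof. by apply: measurable_cons. Qed.

HB.instance Definition _ (n : nat) :=
  isMeasurableFun.Build _ _ _ _ (@tuple_cons n) (@measurable_tuple_cons n).

(* P^n, with P^0 the point mass at the empty tuple and P^(n+1) the image of
   P \x P^n under (x, t) |-> x :: t. *)
Fixpoint iid (P : probability T R) (n : nat) : probability (n.-tuple T) R :=
  match n return probability (n.-tuple T) R with
  | 0 => @dirac _ (0.-tuple T) [tuple] R
  | n'.+1 => distribution (P \x iid P n')%E (@tuple_cons n')
  end.

End product_distribution.

Definition user_neighbors (Z : Type) (n m : nat)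
    (x x' : n.-tuple (m.-tuple Z)) : Prop :=
  exists i : 'I_n, forall j : 'I_n, j != i -> tnth x j = tnth x' j.

Definition user_level_DP (R : realType) (d dY : measure_display)
    (Z : measurableType d) (Y : measurableType dY) (n m : nat) (eps : R)
    (A : R.-pker (n.-tuple (m.-tuple Z)) ~> Y) : Prop :=
  forall x x' : n.-tuple (m.-tuple Z), user_neighbors x x' ->
  forall S : set Y, measurable S -> (A x S <= (expR eps)%:E * A x' S)%E.

Section scores.
Context (R : realType) (d : measure_display) (Z : measurableType d).
Context (H : finType) (psi : H -> H -> Z -> R) (D : probability Z R).

Definition pscore (h h' : H) : \bar R := ('E_D[psi h h'])%E.

(* The maximum of the empty family (when H is a singleton) is -oo. *)
Definition score (h : H) : \bar R :=
  (\big[maxe/-oo]_(h' : H | h' != h) pscore h h')%E.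

End scores.

(* f is Theta-tilde of g on dom: f and g agree up to a constant factor times a
   power of log g; 1 + |ln g| is used so that this factor is never below 1. *)
Definition is_Theta_tilde (R : realType) (P : Type) (dom : set P)
    (f g : P -> R) : Prop :=
  exists (c C : R) (k : nat), [/\ 0 < c, 0 < C &
    forall p, dom p ->
      c * (g p / (1 + `|ln (g p)|) ^+ k) <= f p
        <= C * (g p * (1 + `|ln (g p)|) ^+ k)].

Record selection_params (R : realType) := SelectionParams {
  sp_eps : R;
  sp_alpha : R;
  sp_beta : R;
  sp_card : nat; (* number of candidates *)
  sp_m : nat     (* examples per user *)
}.

Definition admissible (R : realType) (p : selection_params R) : Prop :=
  [/\ 0 < sp_eps p <= 2^-1, 0 < sp_alpha p <= 2^-1, 0 < sp_beta p <= 2^-1,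
      (0 < sp_card p)%N & (0 < sp_m p)%N].

Definition selection_rate (R : realType) (p : selection_params R) : R :=
  let L := ln ((sp_card p)%:R / sp_beta p) in
  L / sp_eps p
  + L / (sp_alpha p * sp_eps p * Num.sqrt (sp_m p)%:R)
  + L / (sp_alpha p ^+ 2 * (sp_m p)%:R).

(* Main.v *)
Require Import Defs.
From HB Require Import structures.
From mathcomp Require Import all_boot all_order all_algebra.
From mathcomp Require Import all_classical all_reals all_analysis.
From mathcomp Require Import measurable_realfun ring lra.

Set Implicit Arguments.
Unset Strict Implicit.
Unset Printing Implicit Defensive.

Import Order.TTheory GRing.Theory Num.Theory.
Import numFieldNormedType.Exports.

Local Open Scope classical_set_scope.
Local Open Scope ring_scope.

(** The mechanism averages, for each user and each pair (h, h'), the comparison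
    over the user's m examples, recentres it at 3 alpha / 10 and clips it to
    [-tau, tau] with tau of order alpha + log / sqrt m.  Clipping moves the
    expectation by at most alpha / 10, so its sign still tells scores below
    alpha / 10 from scores above alpha / 2.  Writing S(h, h') for the sum over
    the users, candidate h is drawn with probability proportional to
    (\sum_h' exp (lam S(h, h')))^-1.  One user changes each S(h, h') by at most
    2 tau, which gives privacy when 4 lam tau <= eps.  The probability of a bad
    h, whose score is large because of g, is at most
    \sum_h' exp (lam (S(h*, h') - S(h, g))).  The expectation of each term is an
    n-th power by independence, and the negative drift makes it at most
    exp (- lam alpha n / 10) as soon as lam is below a constant times
    alpha / tau^2; no concentration inequality for the S(h, h') is needed. *)

Lemma expR_le_quadratic (R : realType) (x : R) :
  x <= 2^-1 -> expR x <= 1 + x + 2 * x ^+ 2.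
Proof.
move=> x12; have x1 : 0 < 1 - x by lra.
rewrite -(ler_pM2r x1) (@le_trans _ _ (expR x * expR (- x)))//.
  by rewrite ler_wpM2l ?expR_ge0//; exact: expR_ge1Dx.
rewrite expRxMexpNx_1 -subr_ge0.
have -> : (1 + x + 2 * x ^+ 2) * (1 - x) - 1 = x ^+ 2 * (1 - 2 * x) by ring.
by rewrite mulr_ge0 ?sqr_ge0//; lra.
Qed.

Section bounded_integrals.
Context {d : measure_display} {T : measurableType d} {R : realType}.

Lemma EFin_Rintegral (mu : {measure set T -> \bar R}) (f : T -> R) :
  mu.-integrable [set: T] (EFin \o f) ->
  (\int[mu]_x (f x)%:E)%E = (\int[mu]_x f x)%:E.
Proof. by move=> intf; rewrite /Rintegral fineK//; exact: integrable_fin_num. Qed.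

Lemma Rintegral_sum (mu : {measure set T -> \bar R}) (I : Type) (s : seq I)
    (f : I -> T -> R) :
  (forall i, mu.-integrable [set: T] (EFin \o f i)) ->
  \int[mu]_x (\sum_(i <- s) f i x) = \sum_(i <- s) \int[mu]_x f i x.
Proof.
move=> intf; rewrite {1}/Rintegral.
under eq_integral do rewrite -sumEFin.
rewrite integral_sum//; under eq_bigr do rewrite EFin_Rintegral//.
by rewrite sumEFin.
Qed.

Lemma ge0_integrable_Rintegral_le (mu : {measure set T -> \bar R}) (f : T -> R)
    (r : R) :
  measurable_fun [set: T] f -> (forall x, 0 <= f x) ->
  (\int[mu]_x (f x)%:E <= r%:E)%E ->
  mu.-integrable [set: T] (EFin \o f) /\ \int[mu]_x f x <= r.
Proof.
move=> mf f0 fr.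
have intf : mu.-integrable [set: T] (EFin \o f).
  apply/integrableP; split; first exact/measurable_EFinP.
  under eq_integral do rewrite /= ger0_norm//.
  by rewrite (le_lt_trans fr)// ltry.
by split => //; rewrite -lee_fin -EFin_Rintegral.
Qed.

Lemma RintegralN (mu : {measure set T -> \bar R}) (f : T -> R) :
  mu.-integrable [set: T] (EFin \o f) -> \int[mu]_x (- f x) = - \int[mu]_x f x.
Proof.
move=> intf; rewrite -mulN1r -RintegralZl//.
by apply: eq_Rintegral => x _; rewrite mulN1r.
Qed.

Lemma bounded_integrable (mu : {finite_measure set T -> \bar R}) (f : T -> R)
    (M : R) :
  measurable_fun [set: T] f -> (forall x, `|f x| <= M) ->
  mu.-integrable [set: T] (EFin \o f).
Proof.
move=> mf fM; apply: measurable_bounded_integrable => //.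
  by rewrite -ge0_fin_numE// fin_num_measure.
by exists M; split; [exact: num_real|move=> y My x _; exact: (le_trans _ (ltW My))].
Qed.

Variable P : probability T R.

Lemma integral_probability_cst (r : \bar R) : (\int[P]_x r = r)%E.
Proof.
rewrite (integral_cst P measurableT r) -[RHS]mule1; congr (_ * _)%E.
exact: probability_setT.
Qed.

Lemma Rintegral_probability_cst (r : R) : \int[P]_x r = r.
Proof. by rewrite /Rintegral integral_probability_cst. Qed.

Lemma integral_expR_le (f : T -> R) (B : R) :
  measurable_fun [set: T] f -> (forall x, `|f x| <= B) -> B <= 2^-1 ->
  (\int[P]_x (expR (f x))%:E <= (expR (\int[P]_x f x + 2 * B ^+ 2))%:E)%E.
Proof.
move=> mf fB B12; have intf := bounded_integrable P mf fB.
have f_le x : f x <= 2^-1 by rewrite (le_trans (ler_norm _))// (le_trans (fB x)).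
have f2_le x : f x ^+ 2 <= B ^+ 2.
  by rewrite -real_normK ?num_real// lerXn2r ?nnegrE// (le_trans _ (fB x)).
have intq : P.-integrable [set: T] (EFin \o (fun x => f x + (1 + 2 * B ^+ 2))).
  exact: (integrableD measurableT intf
    (finite_measure_integrable_cst _ _ measurableT)).
apply: (@le_trans _ _ (\int[P]_x (f x + (1 + 2 * B ^+ 2)))%:E); last first.
  rewrite lee_fin RintegralD//; last exact: finite_measure_integrable_cst.
  by rewrite Rintegral_probability_cst (le_trans _ (expR_ge1Dx _))//; lra.
rewrite -EFin_Rintegral//; apply: ge0_le_integral => //=.
- by apply/measurable_EFinP; exact: measurableT_comp.
- exact: measurable_int intq.
- move=> x _; rewrite lee_fin (le_trans (expR_le_quadratic (f_le x)))//.
  by have := f2_le x; lra.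
Qed.

End bounded_integrals.

Section iid_integrals.
Context {d : measure_display} {T : measurableType d} {R : realType}.
Variable P : probability T R.
Implicit Type n : nat.

Lemma integral_iid0 (f : 0.-tuple T -> \bar R) :
  measurable_fun [set: 0.-tuple T] f -> (\int[iid P 0]_t f t = f [tuple])%E.
Proof. by move=> mf; rewrite /= integral_dirac// diracT mul1e. Qed.

Lemma ge0_integral_iidS n (f : n.+1.-tuple T -> \bar R) :
  measurable_fun [set: n.+1.-tuple T] f -> (forall t, 0 <= f t)%E ->
  (\int[iid P n.+1]_t f t =
   \int[P]_x \int[iid P n]_t f [tuple of x :: t])%E.
Proof.
move=> mf f0 /=.
rewrite ge0_integral_distribution// fubini_tonelli1//; last by move=> x; exact: f0.
by apply: measurableT_comp => //; exact: measurable_tuple_cons.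
Qed.

Lemma measurable_tuple_prod n (f : 'I_n -> T -> R) :
  (forall i, measurable_fun [set: T] (f i)) ->
  measurable_fun [set: n.-tuple T] (fun t => \prod_(i < n) f i (tnth t i)).
Proof.
move=> mf; apply: measurable_prod => i _.
by apply: (measurableT_comp (mf i)); exact: measurable_tnth.
Qed.

Lemma ge0_integral_iid_prod n (f : 'I_n -> T -> R) :
  (forall i, measurable_fun [set: T] (f i)) -> (forall i x, 0 <= f i x) ->
  (\int[iid P n]_t (\prod_(i < n) f i (tnth t i))%:E =
   \prod_(i < n) \int[P]_x (f i x)%:E)%E.
Proof.
elim: n f => [|n ih] f mf f0.
  rewrite integral_iid0 ?big_ord0//.
  by apply/measurable_EFinP; exact: measurable_tuple_prod.
rewrite ge0_integral_iidS; first last.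
- by move=> t; rewrite lee_fin prodr_ge0.
- by apply/measurable_EFinP; exact: measurable_tuple_prod.
pose tail (t : n.-tuple T) := \prod_(i < n) f (lift ord0 i) (tnth t i).
have mtail : measurable_fun [set: n.-tuple T] (EFin \o tail).
  apply/measurable_EFinP.
  exact: (measurable_tuple_prod (fun i => mf (lift ord0 i))).
have tail_ge0 t : (0 <= (tail t)%:E)%E by rewrite lee_fin prodr_ge0.
have split_head x :
    (\int[iid P n]_t (\prod_(i < n.+1) f i (tnth [tuple of x :: t] i))%:E =
     (f ord0 x)%:E * \int[iid P n]_t (tail t)%:E)%E.
  rewrite -ge0_integralZl//; last by rewrite lee_fin.
  apply: eq_integral => t _; rewrite big_ord_recl -EFinM; congr (_ * _)%:E.
  by apply: eq_bigr => i _; rewrite tnthS.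
under eq_integral do rewrite split_head.
rewrite ge0_integralZr//.
- by rewrite big_ord_recl /tail (ih (fun i => f (lift ord0 i))).
- exact/measurable_EFinP.
- by move=> x _; rewrite lee_fin.
- exact: integral_ge0.
Qed.

Lemma ge0_integral_iid_prod_le n (f : T -> R) (r : R) :
  measurable_fun [set: T] f -> (forall x, 0 <= f x) ->
  (\int[P]_x (f x)%:E <= r%:E)%E ->
  (\int[iid P n]_t (\prod_(i < n) f (tnth t i))%:E <= (r ^+ n)%:E)%E.
Proof.
move=> mf f0 fr.
have int_ge0 : (0 <= \int[P]_x (f x)%:E)%E.
  by apply: integral_ge0 => x _; rewrite lee_fin.
have int_fin : (\int[P]_x (f x)%:E)%E \is a fin_num.
  by rewrite ge0_fin_numE// (le_lt_trans fr)// ltry.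
rewrite (@ge0_integral_iid_prod n (fun=> f))// -(fineK int_fin) prodEFin lee_fin.
rewrite prodr_const card_ord lerXn2r ?nnegrE ?fine_ge0//.
  by rewrite -lee_fin (le_trans int_ge0).
by rewrite -lee_fin fineK.
Qed.

Lemma pushforward_iid_tnth n (i : 'I_n) (A : set T) : measurable A ->
  pushforward (iid P n) (fun t => tnth t i) A = P A.
Proof.
move=> mA; pose f (j : 'I_n) : T -> R := if j == i then \1_A else cst 1.
have mf j : measurable_fun [set: T] (f j) by rewrite /f; case: eqP.
have f0 j x : 0 <= f j x by rewrite /f; case: eqP.
have prodE (g : 'I_n -> \bar R) : (forall j, j != i -> g j = 1%E) ->
    (\prod_(j < n) g j = g i)%E.
  by move=> g1; rewrite (bigD1 i)//= big1 ?mule1.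
have := ge0_integral_iid_prod mf f0; rewrite prodE; last first.
  by move=> j /negbTE ji; rewrite /f ji; exact: (integral_probability_cst P 1%E).
rewrite {2}/f eqxx integral_indic// setIT => <-.
rewrite /pushforward -[X in iid _ _ X]setIT -integral_indic//; last first.
  by rewrite -[_ @^-1` _]setTI; exact: measurable_tnth.
apply: eq_integral => t _; rewrite -prodEFin prodE /f ?eqxx//.
by move=> j /negbTE ->.
Qed.

Lemma ge0_integral_iid_tnth n (f : T -> \bar R) (i : 'I_n) :
  measurable_fun [set: T] f -> (forall x, 0 <= f x)%E ->
  (\int[iid P n]_t f (tnth t i) = \int[P]_x f x)%E.
Proof.
move=> mf f0.
rewrite -(@ge0_integral_pushforward _ _ _ _ _ _ (measurable_tnth i) _ setT)//.
apply: eq_measure_integral => [|mtnth A mA _]; first exact: measurable_tnth.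
exact: pushforward_iid_tnth.
Qed.

Lemma integrable_iid_tnth n (f : T -> R) (i : 'I_n) :
  P.-integrable [set: T] (EFin \o f) ->
  (iid P n).-integrable [set: n.-tuple T] (EFin \o (fun t => f (tnth t i))).
Proof.
move=> /integrableP[mf f_fin]; apply/integrableP; split.
  exact: (measurableT_comp mf (measurable_tnth i)).
rewrite (@ge0_integral_iid_tnth _ (fun x => `|(f x)%:E|%E))//.
exact: measurableT_comp.
Qed.

Lemma Rintegral_iid_tnth n (f : T -> R) (i : 'I_n) :
  P.-integrable [set: T] (EFin \o f) ->
  \int[iid P n]_t f (tnth t i) = \int[P]_x f x.
Proof.
move=> intf; congr fine.
rewrite -(@integral_pushforward _ _ _ _ _ _ (measurable_tnth i) _ setT (EFin \o f))//.
- apply: eq_measure_integral => [|mtnth A mA _]; first exact: measurable_tnth.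
  exact: pushforward_iid_tnth.
- exact: measurable_int intf.
- exact: integrable_iid_tnth.
Qed.

End iid_integrals.

Definition tuple_mean (R : realType) (T : Type) (m : nat) (f : T -> R)
    (t : m.-tuple T) : R :=
  (\sum_(i < m) f (tnth t i)) / m%:R.

Section tuple_mean.
Context {d : measure_display} {T : measurableType d} {R : realType}.
Variables (P : probability T R) (m : nat).
Hypothesis m_gt0 : (0 < m)%N.

Lemma measurable_tuple_mean (f : T -> R) :
  measurable_fun [set: T] f -> measurable_fun [set: m.-tuple T] (tuple_mean f).
Proof.
move=> mf; apply: measurable_funM => //; apply: measurable_sum => i.
by apply: (measurableT_comp mf); exact: measurable_tnth.
Qed.

Lemma normr_tuple_mean_le (f : T -> R) (M : R) (t : m.-tuple T) :
  (forall x, `|f x| <= M) -> `|tuple_mean f t| <= M.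
Proof.
move=> fM; rewrite normrM normfV normr_nat ler_pdivrMr ?ltr0n//.
rewrite (le_trans (ler_norm_sum _ _ _))// mulr_natr.
by rewrite -[X in _ *+ X](card_ord m) -sumr_const ler_sum.
Qed.

Lemma Rintegral_tuple_mean (f : T -> R) : P.-integrable [set: T] (EFin \o f) ->
  \int[iid P m]_t tuple_mean f t = \int[P]_x f x.
Proof.
move=> intf; have intfi i := integrable_iid_tnth (n := m) i intf.
rewrite RintegralZr//; last first.
  apply: eq_integrable (integrable_sum measurableT _ (fun i _ => intfi i)) => //.
  by move=> t _; rewrite /= sumEFin.
rewrite Rintegral_sum//; under eq_bigr do rewrite Rintegral_iid_tnth//.
by rewrite sumr_const card_ord -[X in X / _]mulr_natr mulfK// pnatr_eq0 -lt0n.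
Qed.

Lemma integral_expR_tuple_mean_le (f : T -> R) (k B : R) :
  measurable_fun [set: T] f -> (forall x, `|f x| <= B) -> `|k| * B <= m%:R / 2 ->
  (\int[iid P m]_t (expR (k * tuple_mean f t))%:E <=
   (expR (k * \int[P]_x f x + 2 * (k * B) ^+ 2 / m%:R))%:E)%E.
Proof.
move=> mf fB kBm; have m0 : 0 < m%:R :> R by rewrite ltr0n.
pose g x := k / m%:R * f x.
have mg : measurable_fun [set: T] g by exact: measurable_funM.
have gB x : `|g x| <= `|k| * B / m%:R.
  by rewrite !normrM normfV normr_nat mulrAC ler_pM2r ?invr_gt0// ler_wpM2l.
have gB2 : `|k| * B / m%:R <= 2^-1 by rewrite ler_pdivrMr// [leRHS]mulrC.
rewrite (eq_integral (fun t => (\prod_(i < m) expR (g (tnth t i)))%:E)); last first.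
  by move=> t _; rewrite -expR_sum -mulr_sumr mulrA mulrAC.
apply: le_trans (ge0_integral_iid_prod_le m _ _ (integral_expR_le P mg gB gB2)) _.
- exact: measurableT_comp.
- by move=> x; exact: expR_ge0.
rewrite lee_fin -expRM_natl ler_expR RintegralZl//; last first.
  exact: bounded_integrable mf fB.
rewrite !exprMn real_normK ?num_real// le_eqVlt; apply/orP; left; apply/eqP.
by field; rewrite gt_eqF.
Qed.

End tuple_mean.

Definition clip (R : realType) (tau x : R) : R := Num.max (- tau) (Num.min x tau).

(* The margin added to [delta] makes the clipping bias in [Rintegral_clip_le], which
   is [k^-1 * expR (k * (delta - tau) + 1)] at level [tau], at most [delta / 2]. *)
Definition clip_level (R : realType) (k delta : R) : R :=
  delta + k^-1 * (1 + ln (1 + 2 / (k * delta))).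

Section clip.
Context {R : realType}.
Implicit Types k delta tau x y : R.

Lemma clipN tau x : 0 <= tau -> clip tau (- x) = - clip tau x.
Proof.
move=> tau0; rewrite /clip /Num.min /Num.max.
by case: (ltP (- x) tau) => ?; case: (ltP x tau) => ?; repeat case: ltP => ?; lra.
Qed.

Lemma normr_clip tau x : 0 <= tau -> `|clip tau x| <= tau.
Proof.
move=> tau0; rewrite ler_norml /clip /Num.min /Num.max.
by case: (ltP x tau) => ?; case: ltP => ?; lra.
Qed.

Lemma measurable_clip tau : measurable_fun [set: R] (clip tau).
Proof. by apply: measurable_maxr => //; exact: measurable_minr. Qed.

Lemma clip_le_expR tau k x y : 0 < k -> x <= y ->
  clip tau x <= y + k^-1 * expR (k * (- tau - y)).
Proof.
move=> k0 xy; rewrite /clip ge_max ge_min; apply/andP; split; last first.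
  apply/orP; left; apply: (le_trans xy).
  by rewrite lerDl mulr_ge0 ?expR_ge0// invr_ge0 ltW.
have : k * (- tau - y) <= expR (k * (- tau - y)).
  by rewrite (le_trans _ (expR_ge1Dx _))//; lra.
by rewrite -ler_pdivlMl//; lra.
Qed.

Lemma clip_level_ge k delta : 0 < k -> 0 < delta -> delta <= clip_level k delta.
Proof.
move=> k0 d0; rewrite lerDl mulr_ge0 ?invr_ge0 ?(ltW k0)//.
by rewrite addr_ge0// ln_ge0// lerDl divr_ge0// mulr_ge0// ltW.
Qed.

Lemma clip_level_ge0 k delta : 0 < k -> 0 < delta -> 0 <= clip_level k delta.
Proof. by move=> k0 d0; rewrite (le_trans (ltW d0))// clip_level_ge. Qed.

Lemma clip_level_tail_le k delta : 0 < k -> 0 < delta ->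
  k^-1 * expR (k * (delta - clip_level k delta) + 1) <= delta / 2.
Proof.
move=> k0 d0; have kd0 : 0 < k * delta by rewrite mulr_gt0.
have arg0 : 0 < 1 + 2 / (k * delta) by rewrite addr_gt0// divr_gt0.
have -> : k * (delta - clip_level k delta) + 1 = - ln (1 + 2 / (k * delta)).
  by rewrite /clip_level; field; rewrite !gt_eqF.
rewrite expRN lnK// -invfM invf_ple ?posrE ?mulr_gt0// ?divr_gt0//.
have -> : k * (1 + 2 / (k * delta)) = k + (delta / 2)^-1.
  by field; rewrite !gt_eqF.
by lra.
Qed.

End clip.

Lemma integrable_clip (d : measure_display) (T : measurableType d) (R : realType)
    (mu : {finite_measure set T -> \bar R}) (X : T -> R) (tau : R) :
  0 <= tau -> measurable_fun [set: T] X ->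
  mu.-integrable [set: T] (EFin \o (fun t => clip tau (X t))).
Proof.
move=> tau0 mX; apply: (@bounded_integrable _ _ _ _ _ tau).
  exact: (measurableT_comp (measurable_clip tau)).
by move=> t; exact: normr_clip.
Qed.

Section clipped_integrals.
Context {d : measure_display} {T : measurableType d} {R : realType}.
Variables (P : probability T R) (X : T -> R) (k delta : R).
Hypothesis intX : P.-integrable [set: T] (EFin \o X).
Hypotheses (k_gt0 : 0 < k) (delta_gt0 : 0 < delta).
Let tau := clip_level k delta.

Lemma Rintegral_clip_le :
  (\int[P]_t (expR (- k * X t))%:E <= (expR (- k * \int[P]_t X t + 1))%:E)%E ->
  \int[P]_t X t <= - delta -> \int[P]_t clip tau (X t) <= - (delta / 2).
Proof.
set mu := \int[P]_t X t => expX mu_le.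
have mX : measurable_fun [set: T] X.
  by apply/measurable_EFinP; exact: measurable_int intX.
have mexpX : measurable_fun [set: T] (fun t => expR (- k * X t)).
  by apply: measurableT_comp => //; exact: measurable_funM.
have [int_expX {}expX] :=
  ge0_integrable_Rintegral_le mexpX (fun t => expR_ge0 _) expX.
pose y t := X t + (- mu - delta).
have int_y : P.-integrable [set: T] (EFin \o y).
  exact: (integrableD measurableT intX
    (finite_measure_integrable_cst _ _ measurableT)).
pose c := k^-1 * expR (k * (delta - tau + mu)).
have int_cexpX : P.-integrable [set: T] (EFin \o (fun t => c * expR (- k * X t))).
  exact: (integrableZl measurableT c int_expX).
have clip_le t : clip tau (X t) <= y t + c * expR (- k * X t).
  have exponentE : k * (delta - tau + mu) + - k * X t = k * (- tau - y t).
    by rewrite /y; ring.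
  by rewrite /c -mulrA -expRD exponentE clip_le_expR// /y; lra.
apply: (@le_trans _ _ (\int[P]_t (y t + c * expR (- k * X t)))).
  apply: le_Rintegral => //.
    by apply: integrable_clip => //; exact: clip_level_ge0.
  exact: (integrableD measurableT int_y int_cexpX).
rewrite RintegralD// RintegralZl// RintegralD//; last first.
  exact: finite_measure_integrable_cst.
rewrite Rintegral_probability_cst -/mu.
have : c * \int[P]_t expR (- k * X t) <= c * expR (- k * mu + 1).
  by rewrite ler_wpM2l// mulr_ge0 ?expR_ge0// invr_ge0 ltW.
have -> : c * expR (- k * mu + 1) = k^-1 * expR (k * (delta - tau) + 1).
  by rewrite /c -mulrA -expRD; congr (_ * expR _); ring.
by have := clip_level_tail_le k_gt0 delta_gt0; rewrite -/tau; lra.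
Qed.

End clipped_integrals.

Lemma Rintegral_clip_ge (d : measure_display) (T : measurableType d) (R : realType)
    (P : probability T R) (X : T -> R) (k delta : R) :
  P.-integrable [set: T] (EFin \o X) -> 0 < k -> 0 < delta ->
  (\int[P]_t (expR (k * X t))%:E <= (expR (k * \int[P]_t X t + 1))%:E)%E ->
  delta <= \int[P]_t X t ->
  delta / 2 <= \int[P]_t clip (clip_level k delta) (X t).
Proof.
move=> intX k0 d0 expX mu_ge.
have mX : measurable_fun [set: T] X.
  by apply/measurable_EFinP; exact: measurable_int intX.
have intNX : P.-integrable [set: T] (EFin \o (fun t => - X t)).
  exact: (integrableN intX).
have := Rintegral_clip_le intNX k0 d0; rewrite RintegralN// mulrNN lerN2.
under eq_integral do rewrite mulrNN.
move=> /(_ expX mu_ge).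
rewrite (@eq_Rintegral _ _ _ _ _ (fun t => - clip (clip_level k delta) (X t))).
  rewrite RintegralN ?lerN2//.
  by apply: integrable_clip => //; exact: clip_level_ge0.
by move=> t _; rewrite clipN// clip_level_ge0.
Qed.

(* At this rate the exponential moment of the mean of [m] samples in [[-M, M]]
   exceeds its value at the expectation by a factor at most [expR 1]. *)
Definition mean_rate (R : realType) (M : R) (m : nat) : R := Num.sqrt m%:R / (2 * M).

Section clipped_tuple_mean.
Context {d : measure_display} {T : measurableType d} {R : realType}.
Variables (P : probability T R) (m : nat) (f : T -> R) (M delta : R).
Hypotheses (m_gt0 : (0 < m)%N) (M_gt0 : 0 < M) (delta_gt0 : 0 < delta).
Hypothesis measurable_f : measurable_fun [set: T] f.
Hypothesis f_le : forall x, `|f x| <= M.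

Lemma mean_rate_gt0 : 0 < mean_rate M m.
Proof. by rewrite divr_gt0 ?mulr_gt0// sqrtr_gt0 ltr0n. Qed.

Lemma integral_expR_mean_rate_le (k : R) : `|k| = mean_rate M m ->
  (\int[iid P m]_t (expR (k * tuple_mean f t))%:E <=
   (expR (k * \int[iid P m]_t tuple_mean f t + 1))%:E)%E.
Proof.
move=> kE; have intf := bounded_integrable P measurable_f f_le.
have m1 : 1 <= m%:R :> R by rewrite ler1n.
have kM : `|k| * M = Num.sqrt m%:R / 2.
  by rewrite kE /mean_rate; field; rewrite gt_eqF.
rewrite (le_trans (integral_expR_tuple_mean_le _ m_gt0 measurable_f f_le _))//.
  rewrite kM ler_pM2r// -[leRHS]sqr_sqrtr ?ler0n// expr2 ler_peMl ?sqrtr_ge0//.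
  by rewrite -[leLHS]sqrtr1 ler_wsqrtr.
rewrite lee_fin ler_expR Rintegral_tuple_mean// lerD2l.
rewrite exprMn -[k ^+ 2]real_normK ?num_real// -exprMn kM expr_div_n sqr_sqrtr//.
by rewrite -mulrA mulrAC divff ?gt_eqF//; lra.
Qed.

Lemma integrable_tuple_mean :
  (iid P m).-integrable [set: m.-tuple T] (EFin \o tuple_mean f).
Proof.
apply: (@bounded_integrable _ _ _ _ _ M); first exact: measurable_tuple_mean.
by move=> t; exact: normr_tuple_mean_le.
Qed.

Lemma Rintegral_clip_tuple_mean_le : \int[P]_x f x <= - delta ->
  \int[iid P m]_t clip (clip_level (mean_rate M m) delta) (tuple_mean f t) <=
  - (delta / 2).
Proof.
move=> f_le_delta; apply: Rintegral_clip_le => //.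
- exact: integrable_tuple_mean.
- exact: mean_rate_gt0.
- by apply: integral_expR_mean_rate_le; rewrite normrN gtr0_norm// mean_rate_gt0.
- by rewrite Rintegral_tuple_mean//; exact: bounded_integrable measurable_f f_le.
Qed.

Lemma Rintegral_clip_tuple_mean_ge : delta <= \int[P]_x f x ->
  delta / 2 <=
  \int[iid P m]_t clip (clip_level (mean_rate M m) delta) (tuple_mean f t).
Proof.
move=> f_ge_delta; apply: Rintegral_clip_ge => //.
- exact: integrable_tuple_mean.
- exact: mean_rate_gt0.
- by apply: integral_expR_mean_rate_le; rewrite gtr0_norm// mean_rate_gt0.
- by rewrite Rintegral_tuple_mean//; exact: bounded_integrable measurable_f f_le.
Qed.

End clipped_tuple_mean.

Section finite_kernel.
Context {d : measure_display} {X : measurableType d} {R : realType}.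
Variables (H : finType) (h0 : H) (w : X -> H -> R).
Hypothesis w_ge0 : forall x h, 0 <= w x h.

Definition finite_kernel of (forall h, measurable_fun [set: X] (w ^~ h)) :=
  fun x : X => msum (fun k => mscale (NngNum (w_ge0 x (nth h0 (enum H) k)))
    (@dirac _ (discrete h0) (nth h0 (enum H) k) R)) #|H|
  : {measure set (discrete h0) -> \bar R}.

Hypothesis mw : forall h, measurable_fun [set: X] (w ^~ h).

Lemma finite_kernelE (x : X) (S : set (discrete h0)) :
  finite_kernel mw x S = (\sum_h w x h * \1_S (h : discrete h0))%:E.
Proof.
rewrite /finite_kernel /= /msum /mscale /= -sumEFin.
transitivity (\sum_(h in H) (w x h * \1_S (h : discrete h0))%:E)%E; last first.
  exact: eq_bigl.
rewrite [RHS]big_enum_val; apply: eq_bigr => k _.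
by rewrite (enum_val_nth h0) EFinM.
Qed.

Lemma measurable_finite_kernel (S : set (discrete h0)) : measurable S ->
  measurable_fun [set: X] (finite_kernel mw ^~ S).
Proof.
move=> _; under eq_fun do rewrite finite_kernelE.
apply/measurable_EFinP; apply: measurable_sum => h.
exact: measurable_funM.
Qed.

HB.instance Definition _ := isKernel.Build _ _ _ _ R (finite_kernel mw)
  measurable_finite_kernel.

Lemma knormalize_finite_kernelE (P : probability (discrete h0) R) (x : X)
    (S : set (discrete h0)) :
  0 < \sum_h w x h ->
  knormalize (finite_kernel mw) P x S =
  ((\sum_h w x h * \1_S (h : discrete h0)) / \sum_h w x h)%:E.
Proof.
move=> sum_gt0; rewrite /knormalize /= /mnormalize !finite_kernelE.
have -> : \sum_h w x h * \1_[set: discrete h0] (h : discrete h0) = \sum_h w x h.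
  by apply: eq_bigr => h _; rewrite indicT mulr1.
rewrite eqe gt_eqF//= -[LHS]/(finite_kernel mw x S * _)%E.
by rewrite finite_kernelE EFinM.
Qed.

End finite_kernel.

Lemma measurable_fun_invr_gt0 (d : measure_display) (T : measurableType d)
    (R : realType) (f : T -> R) :
  measurable_fun [set: T] f -> (forall x, 0 < f x) ->
  measurable_fun [set: T] (fun x => (f x)^-1).
Proof.
move=> mf f0; have -> : (fun x => (f x)^-1) = (fun x => f x `^ (-1)).
  by apply/funext => x; rewrite powR_inv1// ltW.
exact: (measurableT_comp (measurable_powR _) mf).
Qed.

(* [ln (soft_score h x) / lam] is a soft maximum over [g] of the total of [c h g] on
   the sample [x]; candidates are drawn with probability inversely proportional to
   their [soft_score]. *)
Section soft_selection.
Context {d : measure_display} {T : measurableType d} {R : realType}.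
Variables (H : finType) (h0 : H) (c : H -> H -> T -> R) (lam : R) (n : nat).
Implicit Types (h g hs : H) (x : n.-tuple T) (S : set (discrete h0)).

Definition soft_score h x : R :=
  \sum_g expR (lam * \sum_(i < n) c h g (tnth x i)).

Lemma expR_le_soft_score h g x :
  expR (lam * \sum_(i < n) c h g (tnth x i)) <= soft_score h x.
Proof.
by rewrite /soft_score (bigD1 g)//= lerDl sumr_ge0// => h' _; exact: expR_ge0.
Qed.

Lemma soft_score_gt0 h x : 0 < soft_score h x.
Proof. exact: lt_le_trans (expR_gt0 _) (expR_le_soft_score h h x). Qed.

Lemma soft_scoreV_ge0 x h : 0 <= (soft_score h x)^-1.
Proof. by rewrite invr_ge0 ltW// soft_score_gt0. Qed.

Lemma soft_scoreV_le_sum h x : (soft_score h x)^-1 <= \sum_g (soft_score g x)^-1.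
Proof. by rewrite (bigD1 h)//= lerDl sumr_ge0// => g _; exact: soft_scoreV_ge0. Qed.

Lemma sum_soft_scoreV_gt0 x : 0 < \sum_h (soft_score h x)^-1.
Proof.
by rewrite (lt_le_trans _ (soft_scoreV_le_sum h0 x))// invr_gt0 soft_score_gt0.
Qed.

Hypothesis measurable_c : forall h g, measurable_fun [set: T] (c h g).

Lemma measurable_soft_score h : measurable_fun [set: n.-tuple T] (soft_score h).
Proof.
apply: measurable_sum => g; apply: measurableT_comp => //.
apply: measurable_funM => //; apply: measurable_sum => i.
exact: (measurableT_comp (measurable_c h g) (measurable_tnth i)).
Qed.

Lemma measurable_soft_scoreV h :
  measurable_fun [set: n.-tuple T] (fun x => (soft_score h x)^-1).
Proof.
apply: measurable_fun_invr_gt0; first exact: measurable_soft_score.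
exact: soft_score_gt0.
Qed.

Definition soft_selection : R.-pker (n.-tuple T) ~> discrete h0 :=
  knormalize (finite_kernel h0 soft_scoreV_ge0 measurable_soft_scoreV)
    (@dirac _ (discrete h0) h0 R).

Lemma soft_selectionE x S :
  soft_selection x S =
  ((\sum_h (soft_score h x)^-1 * \1_S (h : discrete h0)) /
   \sum_h (soft_score h x)^-1)%:E.
Proof. by rewrite knormalize_finite_kernelE//; exact: sum_soft_scoreV_gt0. Qed.

Lemma soft_score_neighbor_le (tau : R) (i : 'I_n) x x' h :
  0 <= lam -> (forall h g t, `|c h g t| <= tau) ->
  (forall j, j != i -> tnth x j = tnth x' j) ->
  soft_score h x <= expR (2 * lam * tau) * soft_score h x'.
Proof.
move=> lam0 c_le xx'; rewrite /soft_score mulr_sumr ler_sum// => g _.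
rewrite -expRD ler_expR (bigD1 i)//= [in leRHS](bigD1 i)//=.
rewrite (eq_bigr (fun j => c h g (tnth x' j))); last by move=> j ji; rewrite xx'.
have : lam * (c h g (tnth x i) - c h g (tnth x' i)) <= lam * (tau + tau).
  by rewrite ler_wpM2l// (le_trans (ler_norm _))// (le_trans (ler_normB _ _))// lerD.
by lra.
Qed.

Lemma soft_selection_neighbor_le (tau : R) (i : 'I_n) x x' S :
  0 <= lam -> (forall h g t, `|c h g t| <= tau) ->
  (forall j, j != i -> tnth x j = tnth x' j) ->
  (soft_selection x S <= (expR (4 * lam * tau))%:E * soft_selection x' S)%E.
Proof.
move=> lam0 c_le xx'.
have x'x j : j != i -> tnth x' j = tnth x j by move=> /xx'.
have scoreV_le (y y' : n.-tuple T) h :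
    soft_score h y' <= expR (2 * lam * tau) * soft_score h y ->
    (soft_score h y)^-1 <= expR (2 * lam * tau) * (soft_score h y')^-1.
  by rewrite ler_pdivlMr ?soft_score_gt0// ler_pdivrMl ?soft_score_gt0// mulrC.
have expR_split : expR (4 * lam * tau) = expR (2 * lam * tau) * expR (2 * lam * tau).
  by rewrite -expRD; congr expR; ring.
rewrite !soft_selectionE -EFinM lee_fin expR_split mulrACA.
apply: ler_pM.
- by rewrite sumr_ge0// => h _; rewrite mulr_ge0 ?soft_scoreV_ge0.
- by rewrite invr_ge0 ltW// sum_soft_scoreV_gt0.
- rewrite mulr_sumr ler_sum// => h _; rewrite mulrA ler_wpM2r//.
  exact/scoreV_le/(soft_score_neighbor_le h lam0 c_le x'x).
- rewrite ler_pdivlMr ?sum_soft_scoreV_gt0// ler_pdivrMl ?sum_soft_scoreV_gt0//.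
  rewrite mulrC mulr_sumr ler_sum// => h _.
  exact/scoreV_le/(soft_score_neighbor_le h lam0 c_le xx').
Qed.

Lemma soft_selection_le hs x S :
  (soft_selection x S <=
   (\sum_h soft_score hs x / soft_score h x * \1_S (h : discrete h0))%:E)%E.
Proof.
rewrite soft_selectionE lee_fin ler_pdivrMr ?sum_soft_scoreV_gt0//.
rewrite mulr_suml ler_sum// => h _.
have score_sum_ge1 : 1 <= soft_score hs x * \sum_h (soft_score h x)^-1.
  by rewrite -ler_pdivrMl ?soft_score_gt0// mulr1 soft_scoreV_le_sum.
set weight := _^-1 * _; set total := \sum_h _.
have -> : soft_score hs x / soft_score h x * \1_S (h : discrete h0) * total =
    soft_score hs x * total * weight by rewrite /weight; ring.
by rewrite ler_peMl// mulr_ge0 ?soft_scoreV_ge0.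
Qed.

Lemma soft_score_ratio_ge0 hs h x : 0 <= soft_score hs x / soft_score h x.
Proof. by rewrite divr_ge0 ?ltW ?soft_score_gt0. Qed.

Lemma measurable_soft_score_ratio hs h :
  measurable_fun [set: n.-tuple T] (fun x => soft_score hs x / soft_score h x).
Proof.
apply: measurable_funM; first exact: measurable_soft_score.
exact: measurable_soft_scoreV.
Qed.

Lemma soft_score_ratio_le hs h g x :
  soft_score hs x / soft_score h x <=
  \sum_h' \prod_(i < n) expR (lam * (c hs h' (tnth x i) - c h g (tnth x i))).
Proof.
apply: (@le_trans _ _
    (soft_score hs x / expR (lam * \sum_(i < n) c h g (tnth x i)))).
  rewrite ler_wpM2l ?(ltW (soft_score_gt0 _ _))//.
  by rewrite lef_pV2 ?posrE ?soft_score_gt0 ?expR_gt0// expR_le_soft_score.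
rewrite mulr_suml ler_sum// => h' _.
by rewrite -expRN -expRD -mulrBr -sumrB -expR_sum mulr_sumr.
Qed.

Variable P : probability T R.

Lemma integral_soft_score_ratio_le hs h g (r : R) :
  (forall h', (\int[P]_t (expR (lam * (c hs h' t - c h g t)))%:E <= r%:E)%E) ->
  (\int[iid P n]_x (soft_score hs x / soft_score h x)%:E
    <= (#|H|%:R * r ^+ n)%:E)%E.
Proof.
move=> exp_le; pose e h' t := expR (lam * (c hs h' t - c h g t)).
have e_ge0 h' t : 0 <= e h' t by exact: expR_ge0.
have me h' : measurable_fun [set: T] (e h').
  apply: measurableT_comp => //; apply: measurable_funM => //.
  exact: measurable_funB.
have mprod h' : measurable_fun [set: n.-tuple T]
    (fun x => (\prod_(i < n) e h' (tnth x i))%:E).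
  by apply/measurable_EFinP; exact: (measurable_tuple_prod (fun=> me h')).
have prod_ge0 h' x : (0 <= (\prod_(i < n) e h' (tnth x i))%:E)%E.
  by rewrite lee_fin prodr_ge0.
apply: (@le_trans _ _
    (\int[iid P n]_x \sum_h' (\prod_(i < n) e h' (tnth x i))%:E)%E).
  apply: ge0_le_integral => //.
  - by move=> x _; rewrite lee_fin soft_score_ratio_ge0.
  - by apply/measurable_EFinP; exact: measurable_soft_score_ratio.
  - exact: emeasurable_sum.
  - by move=> x _; rewrite sumEFin lee_fin; exact: soft_score_ratio_le.
rewrite ge0_integral_sum// mulr_natl -sumr_const -sumEFin.
apply: lee_sum => h' _.
exact: (ge0_integral_iid_prod_le n (me h') (e_ge0 h') (exp_le h')).
Qed.

Lemma integral_soft_selection_le hs (S : set (discrete h0)) (b : R) : 0 <= b ->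
  (forall h, S h ->
    (\int[iid P n]_x (soft_score hs x / soft_score h x)%:E <= b%:E)%E) ->
  (\int[iid P n]_x soft_selection x S <= (#|H|%:R * b)%:E)%E.
Proof.
move=> b0 ratio_le.
pose term h x := soft_score hs x / soft_score h x * \1_S (h : discrete h0).
have term_ge0 h x : (0 <= (term h x)%:E)%E.
  by rewrite lee_fin mulr_ge0 ?soft_score_ratio_ge0.
have mterm h : measurable_fun [set: n.-tuple T] (EFin \o term h).
  apply/measurable_EFinP; apply: measurable_funM => //.
  exact: measurable_soft_score_ratio.
apply: (@le_trans _ _ (\int[iid P n]_x \sum_h (term h x)%:E)%E).
  apply: ge0_le_integral => //.
  - exact: (measurable_kernel soft_selection).
  - exact: emeasurable_sum.
  - by move=> x _; rewrite sumEFin; exact: soft_selection_le.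
rewrite ge0_integral_sum// mulr_natl -sumr_const -sumEFin.
apply: lee_sum => h _; rewrite /term indicE.
have [/set_mem Sh|_] := boolP ((h : discrete h0) \in S).
  by under eq_integral do rewrite mulr1; exact: ratio_le.
by under eq_integral do rewrite mulr0; rewrite integral0 lee_fin.
Qed.

End soft_selection.

Lemma soft_selection_DP (d : measure_display) (Z : measurableType d) (R : realType)
    (H : finType) (h0 : H) (m n : nat) (c : H -> H -> m.-tuple Z -> R)
    (lam tau eps : R) (mc : forall h g, measurable_fun [set: m.-tuple Z] (c h g)) :
  0 <= lam -> (forall h g t, `|c h g t| <= tau) -> 4 * lam * tau <= eps ->
  user_level_DP eps (soft_selection h0 lam n mc).
Proof.
move=> lam0 c_le lam_tau x x' [i xx'] S mS.
rewrite (le_trans (soft_selection_neighbor_le mc S lam0 c_le xx'))//.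
by rewrite lee_wpmul2r// lee_fin ler_expR.
Qed.

Lemma integral_pkernel_setC_ge (d d' : measure_display) (X : measurableType d)
    (Y : measurableType d') (R : realType) (P : probability X R)
    (A : R.-pker X ~> Y) (S : set Y) (b : R) : measurable S ->
  (\int[P]_x A x S <= b%:E)%E -> ((1 - b)%:E <= \int[P]_x A x (~` S))%E.
Proof.
move=> mS AS_le; have mC := measurableC mS.
have mA U : measurable U -> measurable_fun [set: X] (A ^~ U).
  exact: measurable_kernel.
have total : (\int[P]_x A x S + \int[P]_x A x (~` S) = 1)%E.
  rewrite -ge0_integralD//; [|exact: mA|exact: mA].
  under eq_integral do rewrite -measureU ?setICr ?setUCr//.
  rewrite -(integral_probability_cst P 1%E); apply: eq_integral => x _.
  exact: prob_kernel.
by rewrite EFinB leeBlDl// -total leeD2r.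
Qed.

Section separation.
Context {R : realType}.
Implicit Types (eps delta tau lam : R).

(* The first summand bounds the privacy loss; the second makes the quadratic term
   of the exponential moment at most half of the linear one. *)
Definition inverse_temperature eps delta tau : R :=
  (4 * tau / eps + 16 * tau ^+ 2 / delta)^-1.

Lemma inverse_temperature_bounds eps delta tau : 0 < eps -> 0 < delta -> 0 < tau ->
  let lam := inverse_temperature eps delta tau in
  [/\ 0 < lam, 4 * lam * tau <= eps & 16 * lam * tau ^+ 2 <= delta].
Proof.
move=> e0 d0 t0; rewrite /inverse_temperature.
have : 0 < 4 * tau / eps by rewrite divr_gt0// mulr_gt0.
have : 0 < 16 * tau ^+ 2 / delta by rewrite divr_gt0// mulr_gt0// exprn_gt0.
set b := _ / delta; set a := _ / eps => b0 a0.
have ab0 : 0 < a + b by rewrite addr_gt0.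
have aE : a * eps = 4 * tau by rewrite /a divfK// gt_eqF.
have bE : b * delta = 16 * tau ^+ 2 by rewrite /b divfK// gt_eqF.
split; first by rewrite invr_gt0.
- rewrite mulrAC -aE ler_pdivrMr// mulrC ler_pM2l//; lra.
- rewrite mulrAC -bE ler_pdivrMr// mulrC ler_pM2l//; lra.
Qed.

Lemma integral_expR_separated_le (d : measure_display) (T : measurableType d)
    (P : probability T R) (X Y : T -> R) lam tau delta :
  measurable_fun [set: T] X -> measurable_fun [set: T] Y ->
  (forall t, `|X t| <= tau) -> (forall t, `|Y t| <= tau) ->
  \int[P]_t X t <= - (delta / 2) -> delta / 2 <= \int[P]_t Y t ->
  0 <= lam -> 4 * lam * tau <= 1 -> 16 * lam * tau ^+ 2 <= delta ->
  (\int[P]_t (expR (lam * (X t - Y t)))%:E <= (expR (- (lam * delta / 2)))%:E)%E.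
Proof.
move=> mX mY Xtau Ytau X_le Y_ge lam0 lam_tau lam_tau2.
have intX := bounded_integrable P mX Xtau; have intY := bounded_integrable P mY Ytau.
have mdiff : measurable_fun [set: T] (fun t => lam * (X t - Y t)).
  by apply: measurable_funM => //; exact: measurable_funB.
have diff_le t : `|lam * (X t - Y t)| <= 2 * lam * tau.
  rewrite normrM ger0_norm// [leRHS](_ : _ = lam * (tau + tau)); last by ring.
  by rewrite ler_wpM2l// (le_trans (ler_normB _ _))// lerD.
apply: (le_trans (integral_expR_le P mdiff diff_le _)); first by lra.
rewrite lee_fin ler_expR RintegralZl ?RintegralB//; last first.
  exact: (integrableB measurableT intX intY).
have : lam * (\int[P]_t X t - \int[P]_t Y t) <= lam * (- delta).
  by rewrite ler_wpM2l//; lra.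
have : lam * (16 * lam * tau ^+ 2) <= lam * delta by rewrite ler_wpM2l.
by rewrite !exprMn; lra.
Qed.

End separation.

Section selection_error.
Context {d : measure_display} {T : measurableType d} {R : realType}.
Variables (H : finType) (h0 : H) (c : H -> H -> T -> R) (lam : R) (n : nat).
Variables (P : probability T R) (tau delta : R).
Hypothesis measurable_c : forall h g, measurable_fun [set: T] (c h g).
Hypothesis c_le : forall h g t, `|c h g t| <= tau.
Hypotheses (lam_ge0 : 0 <= lam) (lam_tau : 4 * lam * tau <= 1).
Hypothesis lam_tau2 : 16 * lam * tau ^+ 2 <= delta.

Lemma integral_soft_selection_separated_le (hs : H) (S : set (discrete h0)) :
  (forall g, \int[P]_t c hs g t <= - (delta / 2)) ->
  (forall h, S h -> exists g, delta / 2 <= \int[P]_t c h g t) ->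
  (\int[iid P n]_x soft_selection h0 lam n measurable_c x S <=
   (#|H|%:R ^+ 2 * expR (- (lam * delta / 2)) ^+ n)%:E)%E.
Proof.
move=> hs_le S_ge; rewrite expr2 -mulrA.
apply: (integral_soft_selection_le _ (hs := hs)) => [|h /S_ge[g g_ge]].
  by rewrite mulr_ge0// exprn_ge0// expR_ge0.
apply: (integral_soft_score_ratio_le n measurable_c (g := g)) => h'.
exact: (integral_expR_separated_le (tau := tau)).
Qed.

End selection_error.

Section scores.
Context {R : realType} {d : measure_display} {Z : measurableType d}.
Variables (H : finType) (psi : H -> H -> Z -> R) (D : probability Z R).
Hypothesis measurable_psi : forall h h' : H, measurable_fun [set: Z] (psi h h').
Hypothesis psi_bound : forall (h h' : H) (z : Z), -1 <= psi h h' z <= 1.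
Implicit Types (a theta : R) (h : H).

Lemma integrable_psi h h' : D.-integrable [set: Z] (EFin \o psi h h').
Proof.
by apply: (@bounded_integrable _ _ _ _ _ 1) => // z; rewrite ler_norml psi_bound.
Qed.

Lemma score_leP h a :
  reflect (forall h', h' != h -> \int[D]_z psi h h' z <= a)
          (score psi D h <= a%:E)%E.
Proof.
have pscoreE h' : pscore psi D h h' = (\int[D]_z psi h h' z)%:E.
  by rewrite /pscore unlock -EFin_Rintegral//; exact: integrable_psi.
apply: (iffP (bigmax_leP _ _ _ _)) => [[_ le_a] h' h'h|le_a].
  by have := le_a _ h'h; rewrite pscoreE lee_fin.
by split => [|h' h'h]; rewrite ?leNye// pscoreE lee_fin le_a.
Qed.

(* On the diagonal, which the score ignores, the comparison is replaced by its
   most favourable value. *)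
Definition shifted_comparison theta h h' (z : Z) : R :=
  (if h' == h then -1 else psi h h' z) - theta.

Lemma measurable_shifted_comparison theta h h' :
  measurable_fun [set: Z] (shifted_comparison theta h h').
Proof. by rewrite /shifted_comparison; case: eqP => _; apply: measurable_funB. Qed.

Lemma normr_shifted_comparison_le theta h h' z : `|theta| <= 1 ->
  `|shifted_comparison theta h h' z| <= 2.
Proof.
rewrite /shifted_comparison !ler_norml => theta1.
by case: eqP => _; have := psi_bound h h' z; lra.
Qed.

Lemma Rintegral_shifted_comparison theta h h' :
  \int[D]_z shifted_comparison theta h h' z =
  (if h' == h then -1 else \int[D]_z psi h h' z) - theta.
Proof.
rewrite /shifted_comparison; case: eqP => _; first exact: Rintegral_probability_cst.
rewrite RintegralB//; [|exact: integrable_psi|exact: finite_measure_integrable_cst].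
by rewrite Rintegral_probability_cst.
Qed.

Lemma Rintegral_shifted_comparison_le theta a h h' : -1 <= a ->
  (score psi D h <= a%:E)%E ->
  \int[D]_z shifted_comparison theta h h' z <= a - theta.
Proof.
move=> a1 /score_leP h_le; rewrite Rintegral_shifted_comparison lerD2r.
by case: eqP => // /eqP; exact: h_le.
Qed.

Lemma Rintegral_shifted_comparison_gt theta a h : ~ (score psi D h <= a%:E)%E ->
  exists h', a - theta < \int[D]_z shifted_comparison theta h h' z.
Proof.
move=> /negP/score_leP /existsNP[h' /not_implyP[h'h /negP]]; rewrite -ltNge => lt_h'.
by exists h'; rewrite Rintegral_shifted_comparison (negbTE h'h) ltrD2r.
Qed.

End scores.

Lemma sample_cost_le (R : realFieldType) (i q u K : R) :
  1 <= i -> 0 <= q -> 1 <= K -> 0 <= u -> u <= K * (1 + q) ->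
  u * i + 4 * u ^+ 2 <= 9 * K ^+ 2 * (i + i * q + q ^+ 2).
Proof.
move=> i1 q0 K1 u0 u_le.
have KK : K <= K ^+ 2 by rewrite expr2 ler_peMl//; lra.
have iq0 : 0 <= i * q by rewrite mulr_ge0//; lra.
have linear_le : u * i <= K ^+ 2 * (i + i * q).
  apply: (@le_trans _ _ (K * (1 + q) * i)); first by rewrite ler_wpM2r//; lra.
  by rewrite -mulrA mulrDl mul1r [q * i]mulrC ler_wpM2r//; lra.
have quadratic_le : u ^+ 2 <= K ^+ 2 * (2 * i + 2 * q ^+ 2).
  apply: (@le_trans _ _ ((K * (1 + q)) ^+ 2)).
    by rewrite lerXn2r ?nnegrE// (le_trans u0).
  rewrite exprMn ler_wpM2l ?sqr_ge0//.
  by have := sqr_ge0 (1 - q); rewrite !expr2; lra.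
have : 0 <= K ^+ 2 * (i * q + q ^+ 2).
  by rewrite mulr_ge0 ?sqr_ge0// addr_ge0 ?sqr_ge0.
have : 0 <= K ^+ 2 * (i * q) by rewrite mulr_ge0 ?sqr_ge0.
by lra.
Qed.

(* [alpha / 5] is the distance of both score thresholds to the shift [3 * alpha / 10],
   and 2 bounds the shifted comparisons. *)
Definition comparison_clip (R : realType) (alpha : R) (m : nat) : R :=
  clip_level (mean_rate 2 m) (alpha / 5).

Definition selection_inverse_temperature (R : realType) (eps alpha : R) (m : nat)
    : R :=
  inverse_temperature eps (alpha / 5) (comparison_clip alpha m).

(* 840 comes from [clip_level_ratio_le], and 144 is 16 times the factor 9 of
   [sample_cost_le]. *)
Definition sample_constant (R : realType) : R := 144 * 840 ^+ 2.

Definition sample_bound (R : realType) (p : selection_params R) : R :=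
  sample_constant R * (selection_rate p * (1 + `|ln (selection_rate p)|) ^+ 2).

Section sample_size.
Context {R : realType}.
Variables (eps alpha beta : R) (k m : nat).
Let p := SelectionParams eps alpha beta k m.
Hypothesis p_admissible : admissible p.
Let g := selection_rate p.
Let L := ln (k%:R / beta).
Let q := (alpha * Num.sqrt m%:R)^-1.
Let tau := comparison_clip alpha m.
Let lam := selection_inverse_temperature eps alpha m.

Lemma comparison_clip_gt0 : 0 < tau.
Proof.
case: p_admissible => /= _ /andP[a0 _] _ _ m0.
by rewrite (lt_le_trans _ (clip_level_ge _ _)) ?mean_rate_gt0// divr_gt0.
Qed.

Lemma ln_confidence_ge : 2^-1 <= L.
Proof.
case: p_admissible => /= _ _ /andP[b0 b12] k0 _.
have k1 : 1 <= k%:R :> R by rewrite ler1n.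
have kb2 : 2 <= k%:R / beta by rewrite ler_pdivlMr//; lra.
rewrite -ler_expR lnK ?posrE; last by rewrite (lt_le_trans _ kb2).
by have := @expR_le_quadratic R 2^-1 (lexx _); rewrite expr2; lra.
Qed.

Lemma mean_scale_gt0 : 0 < q.
Proof.
case: p_admissible => /= _ /andP[a0 _] _ _ m0.
by rewrite invr_gt0 mulr_gt0// sqrtr_gt0 ltr0n.
Qed.

Lemma selection_rateE : g = L * (eps^-1 + eps^-1 * q + q ^+ 2).
Proof.
case: p_admissible => /= /andP[e0 _] /andP[a0 _] _ _ m0.
have s0 : 0 < Num.sqrt m%:R :> R by rewrite sqrtr_gt0 ltr0n.
rewrite /g /selection_rate/= -/L -[in X in _ + X = _](@sqr_sqrtr R m%:R)// /q.
by field; rewrite !gt_eqF.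
Qed.

Lemma selection_rate_ge : 1 <= g /\ q <= g.
Proof.
case: p_admissible => /= /andP[e0 e12] _ _ _ _.
have L12 := ln_confidence_ge; have q0 := mean_scale_gt0.
have e2 : 2 <= eps^-1 by rewrite -[leLHS]invrK lef_pV2 ?posrE// invr_gt0.
have Le1 : 1 <= L * eps^-1 by rewrite -[leLHS](@mulVf _ 2)// ler_pM.
have Lq2 : 0 <= L * q ^+ 2 by rewrite mulr_ge0 ?sqr_ge0//; lra.
have Leq : q <= L * eps^-1 * q by rewrite ler_peMl// ltW.
by rewrite selection_rateE; lra.
Qed.

Lemma clip_level_ratio_le :
  tau / (alpha / 5) <= 840 * (1 + `|ln g|) * (1 + q).
Proof.
have [g1 qg] := selection_rate_ge; have q0 := mean_scale_gt0.
case: p_admissible => /= _ /andP[a0 _] _ _ m0.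
have s0 : 0 < Num.sqrt m%:R :> R by rewrite sqrtr_gt0 ltr0n.
have -> : tau / (alpha / 5) = 1 + 20 * q * (1 + ln (1 + 40 * q)).
  rewrite /tau /comparison_clip /clip_level /mean_rate.
  have -> : 2 / (Num.sqrt m%:R / (2 * 2) * (alpha / 5)) = 40 * q.
    by rewrite /q; field; rewrite !gt_eqF.
  by rewrite /q; field; rewrite !gt_eqF.
have lng : 0 <= ln g by exact: ln_ge0.
have ln_le : 1 + ln (1 + 40 * q) <= 42 * (1 + ln g).
  have : ln (1 + 40 * q) <= ln (41 * g) by rewrite ler_ln ?posrE; lra.
  rewrite lnM ?posrE; [|lra|lra].
  have : ln 41 < 41 :> R by rewrite ln_sublinear.
  by lra.
rewrite ger0_norm//.
have : 20 * q * (1 + ln (1 + 40 * q)) <= 20 * q * (42 * (1 + ln g)).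
  by rewrite ler_pM2l// mulr_gt0.
by lra.
Qed.

Lemma ln_confidence_le (n : nat) : sample_bound p <= n%:R ->
  2 * L <= n%:R * (lam * (alpha / 5) / 2).
Proof.
case: p_admissible => /= /andP[e0 e12] /andP[a0 _] _ _ _.
have d0 : 0 < alpha / 5 by rewrite divr_gt0.
have t0 := comparison_clip_gt0; have L12 := ln_confidence_ge.
have i1 : 1 <= eps^-1 by rewrite invf_ge1//; lra.
have K1 : 1 <= 840 * (1 + `|ln g|) by have := normr_ge0 (ln g); lra.
have u0 : 0 <= tau / (alpha / 5) by rewrite ltW// divr_gt0.
have cost_le := sample_cost_le i1 (ltW mean_scale_gt0) K1 u0 clip_level_ratio_le.
set u := tau / (alpha / 5) in cost_le.
set w := 4 * tau / eps + 16 * tau ^+ 2 / (alpha / 5).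
have w0 : 0 < w by rewrite addr_gt0// divr_gt0 ?mulr_gt0 ?exprn_gt0.
have wE : 4 * L * w / (alpha / 5) = 16 * L * (u * eps^-1 + 4 * u ^+ 2).
  by rewrite /w /u; field; rewrite !gt_eqF.
rewrite /sample_bound /sample_constant -/g; set Lam := 1 + _ in K1 cost_le * => n_ge.
have : 4 * L * w / (alpha / 5) <= n%:R.
  rewrite (le_trans _ n_ge)// wE selection_rateE.
  have : 16 * L * (u * eps^-1 + 4 * u ^+ 2) <=
      16 * L * (9 * (840 * Lam) ^+ 2 * (eps^-1 + eps^-1 * q + q ^+ 2)).
    by rewrite ler_wpM2l//; lra.
  by lra.
have -> : n%:R * (lam * (alpha / 5) / 2) = n%:R * (alpha / 5) / 2 / w.
  by rewrite /lam /selection_inverse_temperature /inverse_temperature -/tau -/w; ring.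
by rewrite ler_pdivlMr// ler_pdivrMr//; lra.
Qed.

Lemma sample_bound_suffices (n : nat) : sample_bound p <= n%:R ->
  k%:R ^+ 2 * expR (- (lam * (alpha / 5) / 2)) ^+ n <= beta.
Proof.
move=> /ln_confidence_le n_ge.
case: p_admissible => /= _ _ /andP[b0 b12] k0 _.
have k1 : 0 < k%:R :> R by rewrite ltr0n.
rewrite -expRM_natl mulrN.
apply: (@le_trans _ _ (k%:R ^+ 2 * expR (- (2 * L)))).
  by rewrite ler_wpM2l ?sqr_ge0// ler_expR lerN2.
rewrite expRN expRM_natl lnK ?posrE ?divr_gt0// expr_div_n invf_div mulrCA.
rewrite divff ?mulr1 ?gt_eqF ?exprn_gt0// expr2 ler_piMl//; lra.
Qed.

End sample_size.

Lemma sample_bound_Theta_tilde (R : realType) :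
  is_Theta_tilde [set p | admissible p] (@sample_bound R) (@selection_rate R).
Proof.
have C0 : 0 < sample_constant R by rewrite /sample_constant; lra.
exists (sample_constant R), (sample_constant R), 2.
split=> // -[eps alpha beta k m] adm.
have [g1 _] := selection_rate_ge adm.
rewrite lexx andbT ler_pM2l// ler_pM2l; last exact: lt_le_trans g1.
set p := SelectionParams _ _ _ _ _ in g1 *.
have Lam1 : 1 <= (1 + `|ln (selection_rate p)|) ^+ 2 by rewrite exprn_ege1// lerDl.
by rewrite (le_trans _ Lam1)// invf_le1// (lt_le_trans ltr01).
Qed.

Section selection_mechanism.
Context {R : realType} {d : measure_display} {Z : measurableType d}.
Variables (H : finType) (h0 : H) (psi : H -> H -> Z -> R).
Variables (eps alpha beta : R) (n m : nat).
Hypothesis measurable_psi : forall h h' : H, measurable_fun [set: Z] (psi h h').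
Hypothesis psi_bound : forall (h h' : H) (z : Z), -1 <= psi h h' z <= 1.
Let p := SelectionParams eps alpha beta #|H| m.
Hypothesis p_admissible : admissible p.
Let tau := comparison_clip alpha m.
Let lam := selection_inverse_temperature eps alpha m.

Definition clipped_comparison h h' (t : m.-tuple Z) : R :=
  clip tau (tuple_mean (shifted_comparison psi (3 * alpha / 10) h h') t).

Lemma measurable_clipped_comparison h h' :
  measurable_fun [set: m.-tuple Z] (clipped_comparison h h').
Proof.
apply: (measurableT_comp (measurable_clip _)).
by apply: measurable_tuple_mean; exact: measurable_shifted_comparison.
Qed.

Lemma normr_clipped_comparison_le h h' t : `|clipped_comparison h h' t| <= tau.
Proof. exact/normr_clip/ltW/(comparison_clip_gt0 p_admissible). Qed.

Definition selection_mechanism : R.-pker n.-tuple (m.-tuple Z) ~> discrete h0 :=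
  soft_selection h0 lam n measurable_clipped_comparison.

Lemma selection_inverse_temperature_bounds :
  [/\ 0 < lam, 4 * lam * tau <= eps & 16 * lam * tau ^+ 2 <= alpha / 5].
Proof.
have t0 := comparison_clip_gt0 p_admissible.
case: p_admissible => /= /andP[e0 _] /andP[a0 _] _ _ _.
by apply: inverse_temperature_bounds => //; rewrite divr_gt0.
Qed.

Lemma selection_mechanism_DP : user_level_DP eps selection_mechanism.
Proof.
have [lam0 lam_eps _] := selection_inverse_temperature_bounds.
exact: soft_selection_DP (ltW lam0) normr_clipped_comparison_le lam_eps.
Qed.

Section accuracy.
Variable D : probability Z R.

Lemma Rintegral_clipped_comparison_le h h' :
  (score psi D h <= (alpha / 10)%:E)%E ->
  \int[iid D m]_t clipped_comparison h h' t <= - (alpha / 5 / 2).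
Proof.
move=> h_good; case: p_admissible => /= _ /andP[a0 a12] _ _ m0.
apply: Rintegral_clip_tuple_mean_le => //.
- by rewrite divr_gt0.
- exact: measurable_shifted_comparison.
- by move=> z; rewrite normr_shifted_comparison_le// ger0_norm; lra.
- have a1 : -1 <= alpha / 10 by lra.
  have := Rintegral_shifted_comparison_le measurable_psi psi_bound
    (3 * alpha / 10) h' a1 h_good.
  by lra.
Qed.

Lemma Rintegral_clipped_comparison_ge h : ~ (score psi D h <= (alpha / 2)%:E)%E ->
  exists h', alpha / 5 / 2 <= \int[iid D m]_t clipped_comparison h h' t.
Proof.
move=> /(Rintegral_shifted_comparison_gt measurable_psi psi_bound (3 * alpha / 10)).
case=> h' h'_gt; exists h'; case: p_admissible => /= _ /andP[a0 a12] _ _ m0.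
apply: Rintegral_clip_tuple_mean_ge => //.
- by rewrite divr_gt0.
- exact: measurable_shifted_comparison.
- by move=> z; rewrite normr_shifted_comparison_le// ger0_norm; lra.
- by lra.
Qed.

Lemma selection_mechanism_error :
  (exists hs, (score psi D hs <= (alpha / 10)%:E)%E) -> sample_bound p <= n%:R ->
  (\int[iid (iid D m) n]_x
      selection_mechanism x (~` [set h : H | (score psi D h <= (alpha / 2)%:E)%E])
    <= beta%:E)%E.
Proof.
move=> [hs hs_good] /(sample_bound_suffices p_admissible) beta_ge.
have [lam0 lam_eps lam_drift] := selection_inverse_temperature_bounds.
have lam1 : 4 * lam * tau <= 1 by case: p_admissible => /= /andP[_ e12] _ _ _ _; lra.
rewrite -lee_fin in beta_ge; apply: le_trans beta_ge.
apply: (integral_soft_selection_separated_le n _ normr_clipped_comparison_le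
  (ltW lam0) lam1 lam_drift (hs := hs)) => [h'|h].
- exact: Rintegral_clipped_comparison_le.
- exact: Rintegral_clipped_comparison_ge.
Qed.

End accuracy.
End selection_mechanism.

Theorem theoremE1 (R : realType) :
  exists n0 : selection_params R -> R,
    is_Theta_tilde [set p | admissible p] n0 (@selection_rate R) /\
    forall (eps alpha beta : R),
      0 < eps <= 2^-1 -> 0 < alpha <= 2^-1 -> 0 < beta <= 2^-1 ->
    forall (d : measure_display) (Z : measurableType d)
      (H : finType) (h0 : H) (psi : H -> H -> Z -> R),
      (forall h h' : H, measurable_fun [set: Z] (psi h h')) ->
      (forall (h h' : H) (z : Z), -1 <= psi h h' z <= 1) ->
    forall n m : nat, (0 < m)%N ->
      n0 (SelectionParams eps alpha beta #|H| m) <= n%:R ->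
    exists A : R.-pker (n.-tuple (m.-tuple Z)) ~> discrete h0,
      user_level_DP eps A /\
      forall D : probability Z R,
        (exists hstar : H, (score psi D hstar <= (alpha / 10)%:E)%E) ->
        ((1 - beta)%:E <=
          \int[iid (iid D m) n]_x
            A x [set h : H | (score psi D h <= (alpha / 2)%:E)%E])%E.
Proof.
exists (@sample_bound R); split; first exact: sample_bound_Theta_tilde.
move=> eps alpha beta he ha hb d Z H h0 psi mpsi psi1 n m m0 n_ge.
have adm : admissible (SelectionParams eps alpha beta #|H| m).
  by split => //=; apply/card_gt0P; exists h0.
exists (selection_mechanism h0 eps alpha n m mpsi); split.
  exact: selection_mechanism_DP adm.
move=> D good; rewrite -[[set h | _]]setCK; apply: integral_pkernel_setC_ge => //.
exact: (selection_mechanism_error h0 mpsi psi1 adm).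
Qed.
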